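(* Let $N\in\mathbb{N}$, let $\tilde W=(\tilde w_{i,j})\in(\mathbb{R}_0^+)^{N\times N}$ be a constant weight matrix with $\tilde w_{i,i}>0$ for all $i$, and let the penaliser be $\Psi=\Psi_{a,1}$ with arbitrary $a>0$. Then, for $t\to\infty$, any initial configuration $v\in(0,1)^N$, evolving according to $$\partial_t v_i=\sum_{j\in J_2^i}\tilde w_{i,j}\,\Phi(v_j-v_i)-\sum_{j=1}^N\tilde w_{i,j}\,\Phi(v_j+v_i),\qquad i=1,\ldots,N,$$ converges to a unique steady state $v^*$, which is the global minimiser of the energy $$E(v,\tilde W)=\frac12\sum_{i=1}^N\sum_{j=1}^N\tilde w_{i,j}\Big(\Psi\big((v_j-v_i)^2\big)+\Psi\big((v_j+v_i)^2\big)\Big).$$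
   Context: $J_2^i:=\{j\in\{1,\ldots,N\}\mid v_j\neq v_i\}$ (depending on the current positions). The evolution is regarded as the gradient descent of $E$. The penaliser $\Psi_{a,1}$ is given by $\Psi_{a,1}(s^2)=a\big((s-1)^2-1\big)$ for $s\in[0,1]$; $s\mapsto\Psi_{a,1}(s^2)$ is extended to $[-1,1]$ by symmetry (evenness) and to $\mathbb{R}$ by periodicity $\Psi((2+s)^2)=\Psi(s^2)$. The flux is $\Phi(s)=\Psi'(s^2)\,s$, i.e. half the derivative of $s\mapsto\Psi(s^2)$, for $s$ not an even integer; thus $\Phi(s)=a(s-1)$ on $(0,2)$, and $\Phi$ is odd and $2$-periodic.
   Formalization: Assumes symmetric weights and a classical solution for all t ≥ 0; v* is the unique steady state (velocity continuously extended at the boundary) and strict energy minimiser only among configurations ordered like v(0) for interacting pairs, since global minimality over (0,1)^N fails in general. *)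

(* Defs.v *)
From HB Require Import structures.
From mathcomp Require Import all_boot all_order all_algebra.
From mathcomp Require Import all_classical all_reals all_analysis.
From mathcomp Require Import ring lra.
Set Implicit Arguments.
Unset Strict Implicit.
Unset Printing Implicit Defensive.
Import Order.TTheory GRing.Theory Num.Theory numFieldNormedType.Exports.
Local Open Scope classical_set_scope.
Local Open Scope ring_scope.

(* The penaliser as a function of the squared distance x = s^2: s is brought
   into [-1, 1[ by subtracting an even integer, and a ((|s| - 1)^2 - 1) is the
   even extension to [-1, 1]; see [Psi01] and [Psi_periodic]. *)
Definition Psi (R : realType) (a x : R) : R :=
  let s := Num.sqrt x in
  let r := s - 2 * (Num.floor ((s + 1) / 2))%:~R in
  a * ((`|r| - 1) ^+ 2 - 1).

Definition Phi (R : realType) (a s : R) : R := derive1 (Psi a) (s ^+ 2) * s.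

Definition energy (R : realType) (N : nat) (W : 'M[R]_N) (a : R)
    (v : 'rV[R]_N) : R :=
  2^-1 * \sum_(i < N) \sum_(j < N) W i j *
    (Psi a ((v ord0 j - v ord0 i) ^+ 2) + Psi a ((v ord0 j + v ord0 i) ^+ 2)).

(* For symmetric W this is - 1/2 times the gradient of the energy, wherever the
   latter is differentiable in the unit box. *)
Definition velocity (R : realType) (N : nat) (W : 'M[R]_N) (a : R)
    (v : 'rV[R]_N) : 'rV[R]_N :=
  \row_i (\sum_(j < N | v ord0 j != v ord0 i)
              W i j * Phi a (v ord0 j - v ord0 i)
          - \sum_(j < N) W i j * Phi a (v ord0 j + v ord0 i)).

(* Classical solutions on [0, +oo[, with the one-sided derivative at 0. *)
Definition evolves (R : realType) (N : nat) (W : 'M[R]_N) (a : R)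
    (v : R -> 'rV[R]_N) : Prop :=
  (h^-1 *: (v h - v 0) @[h --> 0^'+] --> velocity W a (v 0)) /\
  (forall t : R, 0 < t -> is_derive t 1 v (velocity W a (v t))).

Definition unit_box {R : realType} {N : nat} : set 'rV[R]_N :=
  [set u | forall i : 'I_N, 0 < u ord0 i < 1].

(* The configurations in which interacting particles are ordered, and coincide,
   as they do in v.  The sets J_2^i and the signs of the distances between
   interacting particles are constant on it; as s |-> Psi(s^2) is convex on
   [0, 2] but has a concave kink at 0, it is on these sets that the energy is
   convex. *)
Definition chamber (R : realType) (N : nat) (W : 'M[R]_N) (v : 'rV[R]_N) :
    set 'rV[R]_N :=
  unit_box `&`
  [set u | forall i j : 'I_N, 0 < W i j ->
     (u ord0 i <= u ord0 j) = (v ord0 i <= v ord0 j)].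

(* Steady states of the evolution inside A.  The velocity jumps where
   interacting particles meet; on the boundary of a chamber A, it is replaced by
   its continuous extension from A.  For u in A this is velocity W a u = 0. *)
Definition steady_in (R : realType) (N : nat) (W : 'M[R]_N) (a : R)
    (A : set 'rV[R]_N) (u : 'rV[R]_N) : Prop :=
  closure A u /\ velocity W a w @[w --> within A (nbhs u)] --> (0 : 'rV[R]_N).

Lemma PsiE (R : realType) (a s : R) (k : int) : `|s - 2 * k%:~R| <= 1 ->
  Psi a (s ^+ 2) = a * ((`|s - 2 * k%:~R| - 1) ^+ 2 - 1).
Proof.
wlog s0 : s k / 0 <= s => [hw|].
  have [s0|s0 sk] := leP 0 s; first exact: hw.
  rewrite -sqrrN (hw (- s) (- k)) ?oppr_ge0 ?(ltW s0)//.
    by rewrite mulrNz mulrN -opprD normrN.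
  by rewrite mulrNz mulrN -opprD normrN.
move=> sk; rewrite /Psi sqrtr_sqr [`|s|]ger0_norm//=.
have [sk1|sk1] := eqVneq (s - 2 * k%:~R) 1.
  have : Num.floor ((s + 1) / 2) = k + 1.
    rewrite (_ : (s + 1) / 2 = (k + 1)%:~R :> R) ?intrKfloor//.
    by rewrite intrD; lra.
  move->; rewrite sk1 intrD (_ : s - 2 * (k%:~R + 1%:~R) = -1) ?normrN1 ?normr1//.
  lra.
suff -> : Num.floor ((s + 1) / 2) = k by [].
move: sk; rewrite ler_norml => /andP[sk2 sk3].
have sk4 : s - 2 * k%:~R < 1 by rewrite lt_neqAle sk1.
apply: floor_def; rewrite intrD; lra.
Qed.

Lemma Psi01 (R : realType) (a s : R) : 0 <= s <= 1 ->
  Psi a (s ^+ 2) = a * ((s - 1) ^+ 2 - 1).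
Proof.
move=> /andP[s0 s1]; rewrite (@PsiE _ _ _ 0) mulr0 subr0 ger0_norm//.
Qed.

Lemma Psi_periodic (R : realType) (a s : R) :
  Psi a ((2 + s) ^+ 2) = Psi a (s ^+ 2).
Proof.
pose k := Num.floor ((s + 1) / 2).
have sk : `|s - 2 * k%:~R| <= 1.
  have := floor_le ((s + 1) / 2); have := floorD1_gt ((s + 1) / 2).
  by rewrite -/k intrD ler_norml => ? ?; lra.
have kE : 2 + s - 2 * (k + 1)%:~R = s - 2 * k%:~R by rewrite intrD; lra.
by rewrite (PsiE a sk) (@PsiE _ _ _ (k + 1)) kE.
Qed.

Lemma PhiE (R : realType) (a s : R) : 0 < s < 2 -> Phi a s = a * (s - 1).
Proof.
move=> /andP[s0 s2]; rewrite /Phi derive1E.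
have PsiQ : {near s ^+ 2, (fun x => a * ((Num.sqrt x - 1) ^+ 2 - 1)) =1 Psi a}.
  have s2I : s ^+ 2 \in `]0, 4[.
    by rewrite in_itv/= exprn_gt0//=; nra.
  near=> x.
  have : x \in `]0, 4[ by near: x; exact: near_in_itvoo.
  rewrite in_itv/= => /andP[x0 x4].
  have xE : x = Num.sqrt x ^+ 2 by rewrite sqr_sqrtr ?ltW.
  have r0 : 0 < Num.sqrt x by rewrite sqrtr_gt0.
  have r2 : Num.sqrt x < 2 by rewrite -(@ltr_pXn2r _ 2) ?nnegrE// ?ltW//; nra.
  move: (Num.sqrt x) xE r0 r2 => r -> r0 r2.
  have [r1|r1] := leP r 1; first by rewrite Psi01 ?r1 ?ltW.
  have k1 : `|r - 2 * 1%:~R| = 2 - r by rewrite mulr1 ltr0_norm; lra.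
  by rewrite (@PsiE _ _ _ 1) k1; [ring|lra].
rewrite -(near_eq_derive _ PsiQ)//.
have ds : is_derive (s ^+ 2) 1 (@Num.sqrt R) (2 * Num.sqrt (s ^+ 2))^-1.
  by apply: is_derive1_sqrt; rewrite exprn_gt0.
rewrite derive_val sqrtr_sqr gtr0_norm// /GRing.scale/=.
by field; rewrite gt_eqF.
Unshelve. all: by end_near. Qed.

(* Main.v *)
(* On (0, 1) and (0, 2) the flux is affine, so inside the unit box the v_j cancel
   and the evolution decouples up to signs: with D_i = sum_j w_ij and
   S_i = sum_j w_ij sgn (v_j - v_i),
     v_i' = a (D_i (1 - 2 v_i) - S_i).
   Thus v_i' + 2 a D_i v_i takes finitely many values; by Darboux's theorem it is
   constant in time, so v_i tends exponentially to vs_i = (1 - S_i / D_i) / 2,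
   which lies in (0, 1) because w_ii > 0.  For symmetric weights the S_i determine the signs
   sgn (v_j - v_i) of all interacting pairs, so the trajectory stays in its
   chamber, where E(u) - E(vs) = 2 a sum_i D_i (u_i - vs_i)^2. *)
Require Import Defs.
From HB Require Import structures.
From mathcomp Require Import all_boot all_order all_algebra.
From mathcomp Require Import all_classical all_reals all_analysis.
From mathcomp Require Import ring lra.
Import Order.TTheory GRing.Theory Num.Theory numFieldNormedType.Exports.
Local Open Scope classical_set_scope.
Local Open Scope ring_scope.
Set Implicit Arguments.
Unset Strict Implicit.
Unset Printing Implicit Defensive.

(** * Darboux's theorem and scalar linear equations *)

Section darboux.
Context (R : realType).
Implicit Types f df : R -> R.

Lemma is_derive_near_slope f (x d : R) : is_derive x 1 f d -> 0 < d ->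
  \forall h \near 0^', 0 < h^-1 * (f (h + x) - f x).
Proof.
move=> fx d0; have /cvg_ex[/= l fl] := @ex_derive _ _ _ _ _ _ _ fx.
have ld : l = d by rewrite -(@derive_val _ _ _ _ _ _ _ fx); exact/esym/cvg_lim.
have {}fl : h^-1 * (f (h + x) - f x) @[h --> 0^'] --> d.
  suff -> : (fun h => h^-1 * (f (h + x) - f x))
          = (fun h => h^-1 *: (f (h *: 1 + x) - f x)) by rewrite -ld; exact: fl.
  by apply/funext => h; rewrite /GRing.scale/= mulr1.
exact: (cvgr_gt _ fl).
Qed.

Lemma is_derive_gt0_left f (p q d : R) : is_derive q 1 f d -> 0 < d -> p < q ->
  exists2 x, x \in `]p, q[ & f x < f q.
Proof.
move=> fq d0 pq; have sl := is_derive_near_slope fq d0.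
have {}sl : \forall h \near 0^'-, 0 < h^-1 * (f (h + q) - f q).
  move: sl; rewrite !near_withinE; apply: filterS => h + h0.
  by apply; rewrite /= lt_eqF.
near (0 : R)^'- => h.
have h0 : h < 0 by near: h; exact: nbhs_left_lt.
have hpq : p - q < h by near: h; apply: nbhs_left_gt; rewrite subr_lt0.
have : 0 < h^-1 * (f (h + q) - f q) by near: h.
rewrite nmulr_rgt0 ?invr_lt0// subr_lt0 => fh.
by exists (h + q) => //; rewrite in_itv/=; lra.
Unshelve. all: by end_near. Qed.

Lemma is_derive_lt0_right f (p q d : R) : is_derive p 1 f d -> d < 0 -> p < q ->
  exists2 x, x \in `]p, q[ & f x < f p.
Proof.
move=> fp d0 pq.
have sl : \forall h \near 0^'+, 0 < h^-1 * ((- f) (h + p) - (- f) p).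
  have : \forall h \near 0^', 0 < h^-1 * ((- f) (h + p) - (- f) p).
    by apply: (@is_derive_near_slope _ _ (- d)); rewrite oppr_gt0.
  rewrite !near_withinE; apply: filterS => h + h0.
  by apply; rewrite /= gt_eqF.
near (0 : R)^'+ => h.
have h0 : 0 < h by near: h; exact: nbhs_right_gt.
have hpq : h < q - p by near: h; apply: nbhs_right_lt; rewrite subr_gt0.
have : 0 < h^-1 * ((- f) (h + p) - (- f) p) by near: h.
rewrite pmulr_rgt0 ?invr_gt0// !fctE => fh.
by exists (h + p); [rewrite in_itv/=; lra|lra].
Unshelve. all: by end_near. Qed.

(** The signs of [df] at the endpoints make [f] take smaller values just right of [p] and just left
    of [q], so a minimiser over the closed interval is interior and the derivative vanishes
    there. *)
Lemma derive_darboux f df (p q : R) : p < q ->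
  (forall x, x \in `[p, q] -> is_derive x 1 f (df x)) ->
  df p < 0 < df q -> exists2 x, x \in `]p, q[ & df x = 0.
Proof.
move=> pq fd /andP[dp dq].
have pI : p \in `[p, q] by rewrite in_itv/= lexx ltW.
have qI : q \in `[p, q] by rewrite in_itv/= lexx ltW.
have [|c cI cmin] := @EVT_min _ f _ _ (ltW pq).
  by apply: derivable_within_continuous => x /fd [].
have sub x : x \in `]p, q[ -> x \in `[p, q].
  by rewrite !in_itv/= => /andP[/ltW-> /ltW->].
have cE : c \in `]p, q[.
  move: (cI); rewrite !in_itv/= !le_eqVlt => /andP[/orP[/eqP pc|->] /=].
    have [x xI] := is_derive_lt0_right (fd _ pI) dp pq.
    by rewrite pc ltNge cmin// sub.
  move=> /orP[/eqP cq|->//].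
  have [x xI] := is_derive_gt0_left (fd _ qI) dq pq.
  by rewrite -cq ltNge cmin// sub.
exists c => //; have c0 : is_derive c 1 f 0.
  by apply: (derive1_at_min (ltW pq)) cE _ => x xI;
    [have [] := fd _ (sub _ xI)|exact/cmin/sub].
by rewrite -(@derive_val _ _ _ _ _ _ _ (fd _ cI)) (@derive_val _ _ _ _ _ _ _ c0).
Qed.

Lemma exists_notin (s : seq R) (x y : R) : x < y ->
  exists2 m, x < m < y & m \notin s.
Proof.
elim: s x y => [|z s IH] x y xy.
  by exists ((x + y) / 2) => //; lra.
have [m /andP[xm my] ms] := IH x y xy.
have [mz|mz] := eqVneq m z; last first.
  by exists m; rewrite ?xm ?inE ?negb_or ?mz.
(* The point found for the tail is [z] itself; a second search below it avoids [z] too. *)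
have [n /andP[xn nm] ns] := IH x m xm.
exists n; first by rewrite xn (lt_trans nm).
by rewrite inE negb_or ns -mz lt_eqF.
Qed.

(** Integrating factor, with a free constant [m]: it is an intermediate value of the source term in
    [derive_finite_cst], and the source term itself in [linear_ode_sol], where the derivative
    becomes 0. *)
Lemma is_derive_integrating f (x k m d : R) : k != 0 ->
  is_derive x 1 f (d - k * f x) ->
  is_derive x 1 (fun t => (f t - m / k) * expR (k * t))
    (expR (k * x) * (d - m)).
Proof.
move=> k0 fx.
have -> : expR (k * x) * (d - m)
  = (f x - m / k) *: (expR (k * x) * k) + expR (k * x) *: (d - k * f x - 0).
  by rewrite /GRing.scale/=; field.
apply: is_deriveM.
apply: (@is_derive1_comp _ expR (fun t => k * t)).
by apply: is_derive_eq; rewrite /GRing.scale/= mulr1.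
Qed.

(* (f - m / k) e^(k t) has derivative e^(k t) (c - m): if c took two values,
   then, for m between them and outside s, this would contradict Darboux's
   theorem. *)
Lemma derive_finite_cst f (c : R -> R) (k t : R) (s : seq R) : 0 < k -> 0 <= t ->
  (forall x, x \in `[0, t] -> c x \in s) ->
  (forall x, x \in `[0, t] -> is_derive x 1 f (c x - k * f x)) ->
  c t = c 0.
Proof.
move=> k0; rewrite le_eqVlt => /orP[/eqP<-//|t0] cs fd.
have kn0 : k != 0 by rewrite gt_eqF.
pose g m x := (f x - m / k) * expR (k * x).
have gd m x : x \in `[0, t] -> is_derive x 1 (g m) (expR (k * x) * (c x - m)).
  by move=> xI; apply: is_derive_integrating => //; exact: fd.
have sub x : x \in `]0, t[ -> x \in `[0, t].
  by rewrite !in_itv/= => /andP[/ltW-> /ltW->].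
have e0 x := expR_gt0 (k * x).
apply/eqP/negPn/negP => /lt_total /orP[|] lt.
- have [m /andP[m1 m2] ms] := exists_notin s lt.
  (* Here [c t < m < c 0]: the derivative of [g m] goes from positive to negative, hence the sign
     change. *)
  have [||x xI] := @derive_darboux (- g m)
      (fun x => - (expR (k * x) * (c x - m))) _ _ t0.
  - by move=> x xI; apply: is_deriveN; exact: gd.
  - by rewrite oppr_lt0 oppr_gt0 pmulr_rgt0// pmulr_rlt0// subr_gt0 m2 subr_lt0.
  - move=> /eqP; rewrite oppr_eq0 mulf_eq0 gt_eqF//= subr_eq0 => /eqP cx.
    by move: ms; rewrite -cx cs// sub.
- have [m /andP[m1 m2] ms] := exists_notin s lt.
  have [|x xI] := derive_darboux t0 (gd m).
  - by rewrite pmulr_rgt0// pmulr_rlt0// subr_gt0 m2 subr_lt0 m1.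
  - move=> /eqP; rewrite mulf_eq0 gt_eqF//= subr_eq0 => /eqP cx.
    by move: ms; rewrite -cx cs// sub.
Qed.

(** The equation is required only inside the interval, so that the formula reaches an endpoint [t]
    at which the equation is not yet known to hold. *)
Lemma linear_ode_sol f (c k t : R) : k != 0 -> 0 <= t ->
  (forall x, x \in `[0, t] -> derivable f x 1) ->
  (forall x, x \in `]0, t[ -> is_derive x 1 f (c - k * f x)) ->
  f t = c / k + (f 0 - c / k) * expR (- (k * t)).
Proof.
move=> k0 t0 fc fd.
pose g x := (f x - c / k) * expR (k * x).
have gd x : x \in `]0, t[ -> is_derive x 1 g 0.
  move=> xI; rewrite -(mulr0 (expR (k * x))) -(subrr c).
  by apply: is_derive_integrating => //; exact: fd.
have cg : {within `[0, t], continuous g}.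
  apply: derivable_within_continuous => x /fc fx.
  (* At an endpoint the derivative is unknown; this trivial rewriting lets [is_derive_integrating]
     give at least the derivability of [g]. *)
  have fx' : is_derive x 1 f ('D_1 f x + k * f x - k * f x).
    by rewrite addrK; exact: derivableP.
  by have [] := is_derive_integrating c k0 fx'.
have [x _] := MVT_segment t0 gd cg.
rewrite mul0r /g mulr0 expR0 mulr1 expRN => /eqP; rewrite subr_eq0 => /eqP <-.
by rewrite mulfK ?gt_eqF ?expR_gt0// addrC subrK.
Qed.

End darboux.

(** * Sign sums, chambers and the energy *)

Definition degree (R : realType) (N : nat) (W : 'M[R]_N) (i : 'I_N) : R :=
  \sum_(j < N) W i j.

Definition sign_sum (R : realType) (N : nat) (W : 'M[R]_N) (v : 'rV[R]_N)
    (i : 'I_N) : R :=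
  \sum_(j < N) W i j * Num.sg (v ord0 j - v ord0 i).

Definition target (R : realType) (N : nat) (W : 'M[R]_N) (v : 'rV[R]_N) :
    'rV[R]_N :=
  \row_i ((1 - sign_sum W v i / degree W i) / 2).

Lemma PhiN (R : realType) (a s : R) : Phi a (- s) = - Phi a s.
Proof. by rewrite /Phi sqrrN mulrN. Qed.

Lemma Phi_sg (R : realType) (a s : R) : s != 0 -> -2 < s < 2 ->
  Phi a s = a * (s - Num.sg s).
Proof.
move=> s0 /andP[s2 s2']; have [sp|sn|/eqP] := ltgtP s 0.
- by rewrite -[s]opprK PhiN PhiE ?ltr0_sg ?opprK//; [ring | lra].
- by rewrite PhiE ?gtr0_sg// sn.
- by rewrite (negPf s0).
Qed.

Section interaction.
Context (R : realType) (N : nat) (W : 'M[R]_N) (a : R).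
Hypothesis W_ge0 : forall i j : 'I_N, 0 <= W i j.
Hypothesis W_diag : forall i : 'I_N, 0 < W i i.
Implicit Types u v x y : 'rV[R]_N.

Lemma degree_gt0 i : 0 < degree W i.
Proof.
rewrite /degree (bigD1 i)//=; apply: ltr_wpDr (W_diag i).
by apply: sumr_ge0.
Qed.

Lemma target_in_box v : unit_box (target W v).
Proof.
move=> i; rewrite mxE; have D0 := degree_gt0 i.
suff : `|sign_sum W v i| < degree W i.
  rewrite ltr_norml => /andP[S1 S2].
  have : -1 < sign_sum W v i / degree W i by rewrite ltr_pdivlMr// mulN1r.
  have : sign_sum W v i / degree W i < 1 by rewrite ltr_pdivrMr// mul1r.
  by move=> ? ?; lra.
(* The diagonal term has sign 0 in [sign_sum] but weight [W i i > 0] in [degree], which makes the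
   bound strict. *)
rewrite /sign_sum /degree [X in `|X|](bigD1 i)//= [ltRHS](bigD1 i)//=.
rewrite subrr sgr0 mulr0 add0r (le_lt_trans (ler_norm_sum _ _ _))//.
rewrite ltr_pwDl// ler_sum// => j _.
rewrite normrM (ger0_norm (W_ge0 i j)) ler_piMr//.
by rewrite normr_sg; case: (_ != _).
Qed.

Lemma velocityE v i : unit_box v ->
  velocity W a v ord0 i
  = a * (degree W i * (1 - 2 * v ord0 i) - sign_sum W v i).
Proof.
move=> vbox; rewrite mxE big_mkcond/= -sumrB /degree /sign_sum.
rewrite mulrBr mulr_suml !mulr_sumr -sumrB; apply: eq_bigr => j _.
have /andP[vi0 vi1] := vbox i; have /andP[vj0 vj1] := vbox j.
rewrite (@PhiE _ a (v ord0 j + v ord0 i)); last lra.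
(* Pairs left out of the first sum obey the same formula, since their sign is 0. *)
have [->|vij] := eqVneq (v ord0 j) (v ord0 i) => /=.
  by rewrite subrr sgr0; ring.
rewrite Phi_sg; [by ring | by rewrite subr_eq0 | lra].
Qed.

Lemma velocity_target v i : unit_box v ->
  velocity W a v ord0 i
  = 2 * a * degree W i * (target W v ord0 i - v ord0 i).
Proof.
move=> vbox; rewrite velocityE// mxE.
by field; rewrite gt_eqF ?degree_gt0.
Qed.

Hypothesis W_sym : W^T = W.

Let WC i j : W i j = W j i. Proof. by rewrite -[in LHS]W_sym mxE. Qed.

(** Summation by parts: for symmetric [W] the kernel [W i j * sg (x_j - x_i)] is antisymmetric, so
    symmetrising the double sum produces the differences [u_j - u_i]. *)
Lemma sum_sign_sum x u :
  (\sum_i sign_sum W x i * u ord0 i) *+ 2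
  = - \sum_i \sum_j W i j * (Num.sg (x ord0 j - x ord0 i)
                             * (u ord0 j - u ord0 i)).
Proof.
pose F i j := W i j * Num.sg (x ord0 j - x ord0 i) * u ord0 i.
transitivity (\sum_i \sum_j (F i j + F j i)).
  under [RHS]eq_bigr do rewrite big_split/=.
  rewrite [RHS]big_split/= [X in _ = _ + X]exchange_big/= -mulr2n.
  congr (_ *+ 2).
  by apply: eq_bigr => i _; rewrite -mulr_suml.
rewrite -sumrN; apply: eq_bigr => i _; rewrite -sumrN; apply: eq_bigr => j _.
rewrite /F (WC j i) -(opprB (x ord0 j)) sgrN; ring.
Qed.

(* Pairing S(x) - S(y) with x gives a sum of nonnegative terms. *)
Lemma sign_sum_sg x y : (forall i, sign_sum W x i = sign_sum W y i) ->
  forall i j, 0 < W i j -> x ord0 i != x ord0 j ->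
  Num.sg (y ord0 j - y ord0 i) = Num.sg (x ord0 j - x ord0 i).
Proof.
move=> Sxy i j Wij xij.
(* Up to the weight, [T i j] is [|x_j - x_i|] minus a term of at most that modulus. *)
pose T i j := W i j * ((Num.sg (x ord0 j - x ord0 i)
  - Num.sg (y ord0 j - y ord0 i)) * (x ord0 j - x ord0 i)).
have T0 k l : 0 <= T k l.
  rewrite mulr_ge0// mulrBl -normrEsg subr_ge0.
  rewrite (le_trans (ler_norm _))// normrM ler_piMl// normr_sg.
  by case: (_ != _).
have : \sum_i \sum_j T i j = 0.
  have : (\sum_i sign_sum W x i * x ord0 i) *+ 2
       = (\sum_i sign_sum W y i * x ord0 i) *+ 2.
    by under eq_bigr do rewrite Sxy.
  rewrite !sum_sign_sum => /oppr_inj /eqP; rewrite -subr_eq0 => /eqP.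
  rewrite -sumrB => S0; rewrite -[RHS]S0; apply: eq_bigr => k _; rewrite -sumrB.
  by apply: eq_bigr => l _; rewrite /T mulrBl mulrBr.
move/eqP; rewrite psumr_eq0; last by move=> k _; exact: sumr_ge0.
move/allP/(_ i); rewrite mem_index_enum => /(_ isT); rewrite psumr_eq0//.
move/allP/(_ j); rewrite mem_index_enum => /(_ isT); rewrite /T.
rewrite !mulf_eq0 gt_eqF//= [x ord0 j - _ == 0]subr_eq0.
by rewrite [x ord0 j == _]eq_sym (negPf xij) orbF subr_eq0 => /eqP.
Qed.

(** Describes the chamber by the quantities that the evolution conserves. *)
Lemma chamber_sign_sum x u : unit_box u ->
  chamber W x u <-> forall i, sign_sum W u i = sign_sum W x i.
Proof.
move=> ubox; split=> [[_ ux] i|uS].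
  apply: eq_bigr => j _.
  have := W_ge0 i j; rewrite le_eqVlt => /orP[/eqP<-|Wij]; rewrite ?mul0r//.
  congr (_ * _); have := ux _ _ Wij; rewrite WC in Wij; have := ux _ _ Wij.
  move: (u ord0 i) (u ord0 j) (x ord0 i) (x ord0 j) => s s' r r'.
  case: (ltgtP s s') => ss'; case: (ltgtP r r') => rr'//= _ _.
  - by rewrite !gtr0_sg ?subr_gt0.
  - by rewrite !ltr0_sg ?subr_lt0.
  - by rewrite ss' rr' !subrr.
split=> // i j Wij.
(* [sign_sum_sg] needs a pair distinct in its first configuration; used both ways, it leaves only
   pairs that coincide in both. *)
have xu := sign_sum_sg (fun i => esym (uS i)) Wij.
have ux := sign_sum_sg uS Wij.
rewrite -[LHS]subr_ge0 -[RHS]subr_ge0 -sgr_ge0 -[RHS]sgr_ge0.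
have [e|/xu -> //] := eqVneq (x ord0 i) (x ord0 j).
have [e'|/ux -> //] := eqVneq (u ord0 i) (u ord0 j).
by rewrite e e' !subrr.
Qed.

Lemma chamber_target x u : chamber W x u -> target W u = target W x.
Proof.
move=> ux; have /(chamber_sign_sum x) [/(_ ux) uS _] := ux.1.
by apply/rowP => i; rewrite !mxE uS.
Qed.

(** The order of interacting particles is not a closed condition, but this identity, with the signs
    frozen at [x], is; it holds on the chamber and passes to limits. *)
Lemma closure_chamber x u : closure (chamber W x) u ->
  (forall i, 0 <= u ord0 i <= 1) /\
  (forall i j, 0 < W i j -> `|u ord0 j - u ord0 i|
     = Num.sg (x ord0 j - x ord0 i) * (u ord0 j - u ord0 i)).
Proof.
move=> xu; have cf i : continuous (fun w : 'rV[R]_N => w ord0 i).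
  exact: coord_continuous.
have clU (D : set 'rV[R]_N) : closed D -> chamber W x `<=` D -> D u.
  by move=> /closure_id {2}-> /closureS; exact.
split=> [i|i j Wij].
  apply/andP; split.
    apply: (clU [set w | 0 <= w ord0 i]) => [|w [wbox _]].
      by apply: (preimage_closed (in1W (cf i)) (@closed_ge _ 0)).
    by have /andP[/ltW] := wbox i.
  apply: (clU [set w | w ord0 i <= 1]) => [|w [wbox _]].
    by apply: (preimage_closed (in1W (cf i)) (@closed_le _ 1)).
  by have /andP[_ /ltW] := wbox i.
pose g (w : 'rV[R]_N) := `|w ord0 j - w ord0 i|
  - Num.sg (x ord0 j - x ord0 i) * (w ord0 j - w ord0 i).
apply/eqP; rewrite -subr_eq0; apply/eqP.
apply: (clU [set w | g w = 0]) => [|w [_ wx]].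
  apply: (@preimage_closed _ _ g _ _ (@closed_eq _ 0)) => w _.
  have cd : (v ord0 j - v ord0 i) @[v --> w] --> w ord0 j - w ord0 i.
    by apply: cvgB; exact: cf.
  by apply: cvgB (cvg_norm cd) (cvgM (cvg_cst _) cd).
rewrite /= /g; have := wx _ _ Wij; rewrite WC in Wij; have := wx _ _ Wij.
move: (w ord0 i) (w ord0 j) (x ord0 i) (x ord0 j) => s s' r r'.
case: (ltgtP s s') => ss'; case: (ltgtP r r') => rr'//= _ _;
  rewrite ?ss' ?subrr ?normr0 ?mulr0 ?subr0//.
- by rewrite gtr0_sg ?subr_gt0// gtr0_norm ?subr_gt0// mul1r subrr.
- by rewrite ltr0_sg ?subr_lt0// ltr0_norm ?subr_lt0// mulN1r subrr.
Qed.

(** With frozen signs the moduli become linear, and the products [u_i u_j] cancel between the two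
    squares, so the energy is a separable quadratic. *)
Lemma energyE x u : closure (chamber W x) u ->
  energy W a u = 2 * a * \sum_i degree W i *
    ((u ord0 i - target W x ord0 i) ^+ 2 - target W x ord0 i ^+ 2).
Proof.
(* [F i j] below is the share of the pair's energy that depends on [u_i] alone. *)
move=> /closure_chamber[u01 usg].
pose F i j := W i j * (a * (u ord0 i ^+ 2 - u ord0 i
  + Num.sg (x ord0 j - x ord0 i) * u ord0 i)).
transitivity (\sum_i \sum_j (F i j + F j i)).
  rewrite /energy mulr_sumr; apply: eq_bigr => i _.
  rewrite mulr_sumr; apply: eq_bigr => j _.
  have := W_ge0 i j; rewrite le_eqVlt => /orP[/eqP W0|Wij].
    by rewrite /F (WC j i) -W0; ring.
  have /andP[ui0 ui1] := u01 i; have /andP[uj0 uj1] := u01 j.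
  have d1 : `|u ord0 j - u ord0 i| <= 1 by rewrite ler_norml; lra.
  rewrite (@PsiE _ a (u ord0 j - u ord0 i) 0) mulr0 subr0//.
  (* The parabola is symmetric about 1, so its formula extends from [[0, 1]] to [[0, 2]]. *)
  have -> : Psi a ((u ord0 j + u ord0 i) ^+ 2)
          = a * ((u ord0 j + u ord0 i - 1) ^+ 2 - 1).
    have [s1|s1] := leP (u ord0 j + u ord0 i) 1; first by rewrite Psi01; lra.
    have k1 : `|u ord0 j + u ord0 i - 2 * 1%:~R| = 2 - (u ord0 j + u ord0 i).
      by rewrite mulr1 ler0_norm; lra.
    by rewrite (@PsiE _ _ _ 1) k1; [ring|lra].
  rewrite sqrrB1 real_normK ?num_real// usg//.
  rewrite /F (WC j i) -(opprB (x ord0 j)) sgrN mulNr.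
  by field.
under eq_bigr do rewrite big_split/=.
rewrite big_split/= [X in _ + X]exchange_big/= -mulr2n -[LHS]mulr_natl -mulrA.
congr (_ * _); rewrite mulr_sumr; apply: eq_bigr => i _.
transitivity (a * (degree W i * (u ord0 i ^+ 2 - u ord0 i)
   + sign_sum W x i * u ord0 i)).
  rewrite /degree /sign_sum !mulr_suml -big_split/= mulr_sumr.
  by apply: eq_bigr => j _; rewrite /F; ring.
(* Completing the square: the target [y] satisfies [2 D_i y_i = D_i - S_i]. *)
by rewrite mxE; field; rewrite gt_eqF ?degree_gt0.
Qed.

End interaction.

(** * The initial time, and passage to coordinates *)

Lemma is_derive_glue (R : realType) (V : normedModType R) (f : R -> V) (l : V) :
  h^-1 *: (f h - f 0) @[h --> 0^'+] --> l ->
  is_derive (0 : R) 1 (fun t => if t <= 0 then f 0 + t *: l else f t) l.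
Proof.
move=> fl; set g := (X in is_derive _ _ X _).
suff gl : h^-1 *: (g (h *: 1 + 0) - g 0) @[h --> 0^'] --> l.
  by apply: DeriveDef; [apply/cvg_ex; exists l; exact: gl | exact: cvg_lim gl].
apply/cvgrPdist_lt => e e0; move/cvgrPdist_lt : fl => /(_ e e0).
rewrite !near_withinE; apply: filterS => h + hn0.
rewrite /g lexx scale0r !addr0 [h *: 1]mulr1.
case: ltP => [h0 /(_ isT)//|h0 _].
(* To the left of 0 the difference quotient is exactly [l]. *)
by rewrite [f 0 + _]addrC addrK scalerA mulVf// scale1r subrr normr0.
Qed.

Lemma is_derive_coord (R : realType) (N : nat) (v : R -> 'rV[R]_N) (t : R)
    (d : 'rV[R]_N) (i : 'I_N) :
  is_derive t 1 v d -> is_derive t 1 (fun x => v x ord0 i) (d ord0 i).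
Proof.
move=> [vt vd]; apply: DeriveDef; first exact: (derivable_mxP v t 1).1.
by rewrite -vd derive_mx// mxE.
Qed.

Lemma cvg_row (R : realType) (N : nat) (T : Type) (F : set_system T)
    (FF : Filter F) (f : T -> 'rV[R]_N) (l : 'rV[R]_N) :
  (forall i, f x ord0 i @[x --> F] --> l ord0 i) -> f x @[x --> F] --> l.
Proof.
move=> fl; apply/cvgrPdist_le => e e0; near=> x.
rewrite /Num.Def.normr/= mx_normrE (bigmax_le _ (ltW e0))//= => -[k i] _.
rewrite !mxE/= ord1; move: i; near: x; apply: filter_forall => i.
exact: ((cvgrPdist_le _ _).1 (fl i)).
Unshelve. all: by end_near. Qed.

Lemma near_unit_box (R : realType) (N : nat) (v : R -> 'rV[R]_N) (t : R) :
  unit_box (v t) -> (forall i, {for t, continuous (fun x => v x ord0 i)}) ->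
  \forall x \near t, unit_box (v x).
Proof.
move=> vt vc; pose P i x := 0 < v x ord0 i < 1.
apply: (@filter_forall _ _ P (nbhs t) _) => i; have /andP[v0 v1] := vt i.
near=> x; apply/andP; split; near: x.
- exact: (cvgr_gt _ (vc i)).
- exact: (cvgr_lt _ (vc i)).
Unshelve. all: by end_near. Qed.

(** Continuing [v] to the left of 0 along its tangent line makes the derivative at 0 two-sided, so
    that the results on closed intervals [[0, t]] apply. *)
Lemma evolves_ext (R : realType) (N : nat) (W : 'M[R]_N) (a : R)
    (v : R -> 'rV[R]_N) : evolves W a v ->
  exists w : R -> 'rV[R]_N, (forall t : R, 0 <= t -> w t = v t) /\
    forall t : R, 0 <= t -> is_derive t 1 w (velocity W a (w t)).
Proof.
move=> [v0 vt].
pose w (t : R) := if t <= 0 then v 0 + t *: velocity W a (v 0) else v t.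
have wv t : 0 <= t -> w t = v t.
  by rewrite /w le_eqVlt => /orP[/eqP<-|/lt_geF->//]; rewrite lexx scale0r addr0.
exists w; split=> // t t0; rewrite wv//.
move: t0; rewrite le_eqVlt => /orP[/eqP<-|t0]; first exact: is_derive_glue.
apply: near_eq_is_derive (vt _ t0); near=> x.
by rewrite /w lt_geF//; near: x; exact: lt_nbhsr.
Unshelve. all: by end_near. Qed.

(** * Invariance of the box, conserved signs and convergence *)

Section trajectory.
Context (R : realType) (N : nat) (W : 'M[R]_N) (a : R) (v : R -> 'rV[R]_N).
Hypothesis W_ge0 : forall i j : 'I_N, 0 <= W i j.
Hypothesis W_diag : forall i : 'I_N, 0 < W i i.
Hypothesis a_gt0 : 0 < a.
Hypothesis v0_box : unit_box (v 0).
Hypothesis vd : forall t : R, 0 <= t -> is_derive t 1 v (velocity W a (v t)).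

Let rate i := 2 * a * degree W i.

Let rate_gt0 i : 0 < rate i.
Proof. by rewrite !mulr_gt0// degree_gt0. Qed.

Let vid (t : R) i : 0 <= t ->
  is_derive t 1 (fun x => v x ord0 i) (velocity W a (v t) ord0 i).
Proof. by move=> t0; apply: is_derive_coord; exact: vd. Qed.

(** The finitely-valued source term to which [derive_finite_cst] is applied. *)
Let speed (x : R) i := a * (degree W i - sign_sum W (v x) i).

Let vid_box (t : R) i : 0 <= t -> unit_box (v t) ->
  is_derive t 1 (fun x => v x ord0 i) (speed t i - rate i * v t ord0 i).
Proof.
move=> t0 vt; have := vid i t0; rewrite velocityE//.
by congr is_derive; rewrite /speed /rate; ring.
Qed.

(** Each sign is a difference of two truth values, so finitely many Boolean patterns produce all
    sums. *)
Lemma sign_sum_finite i : exists s : seq R, forall u, sign_sum W u i \in s.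
Proof.
exists [seq \sum_j W i j * ((q j).1%:R - (q j).2%:R)
       | q : {ffun 'I_N -> bool * bool}] => u.
apply/mapP.
exists [ffun j => (0 < u ord0 j - u ord0 i, u ord0 j - u ord0 i < 0)].
  by rewrite mem_enum.
by apply: eq_bigr => j _; rewrite ffunE/=; case: sgrP; rewrite ?subr0 ?sub0r.
Qed.

Lemma box_sign_sum (t : R) i : 0 <= t ->
  (forall x, x \in `[0, t] -> unit_box (v x)) ->
  sign_sum W (v t) i = sign_sum W (v 0) i.
Proof.
move=> t0 box; have [s sP] := sign_sum_finite i.
have := @derive_finite_cst _ (fun x => v x ord0 i) (speed ^~ i) (rate i) t
  [seq a * (degree W i - y) | y <- s] (rate_gt0 i) t0.
have -> // : (speed t i = speed 0 i)
    <-> (sign_sum W (v t) i = sign_sum W (v 0) i).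
  split=> [|eS]; last by rewrite /speed eS.
  by move=> /(mulfI (lt0r_neq0 a_gt0))/addrI/oppr_inj.
apply=> x xI; first exact: map_f.
by apply: vid_box; [move: xI; rewrite in_itv => /andP[]|exact: box].
Qed.

Lemma box_sol (t : R) i : 0 <= t -> (forall x, x \in `[0, t[ -> unit_box (v x)) ->
  v t ord0 i = target W (v 0) ord0 i
    + (v 0 ord0 i - target W (v 0) ord0 i) * expR (- (rate i * t)).
Proof.
move=> t0 box.
have -> : target W (v 0) ord0 i = speed 0 i / rate i.
  rewrite mxE /speed /rate; field.
  by rewrite !gt_eqF ?degree_gt0.
apply: (@linear_ode_sol _ (fun x => v x ord0 i)) => //.
- by rewrite gt_eqF.
- by move=> x; rewrite in_itv/= => /andP[x0 _]; have [] := vid i x0.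
- move=> x; rewrite in_itv/= => /andP[x0 xt].
  have -> : speed 0 i = speed x i.
    rewrite /speed (@box_sign_sum x) ?(ltW x0)// => y.
    rewrite in_itv/= => /andP[y0 yx].
    by apply: box; rewrite in_itv/= y0 (le_lt_trans yx).
  by apply: vid_box; [exact: ltW|apply: box; rewrite in_itv/= ltW].
Qed.

(** By [box_sol], each coordinate of [v t] is a convex combination of those of [v 0] and of the
    target, both inside the box. *)
Lemma box_closed (t : R) : 0 <= t ->
  (forall x, x \in `[0, t[ -> unit_box (v x)) ->
  unit_box (v t).
Proof.
move=> t0 box i; rewrite (box_sol i t0 box).
have /andP[v0 v1] := v0_box i.
have /andP[s0 s1] := target_in_box W_ge0 W_diag (v 0) i.
move: (expR_gt0 (- (rate i * t))).
have : expR (- (rate i * t)) <= 1.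
  by rewrite -expR0 ler_expR oppr_le0 mulr_ge0// ltW.
move: (expR _) => e e1 e0; nra.
Qed.

(** Continuation argument: at the infimum of the times outside the box, [box_closed] still puts [v]
    inside; the box being open, [v] stays there a little longer, a contradiction. *)
Lemma trajectory_in_box (t : R) : 0 <= t -> unit_box (v t).
Proof.
move=> t0; apply: contrapT => vt.
pose B := [set x | 0 <= x /\ ~ unit_box (v x)].
have Blb : lbound B 0 by move=> x [].
have Bn0 : B !=set0 by exists t.
have Binf : has_inf B by split=> //; exists 0.
have T0 : 0 <= inf B by exact: lb_le_inf.
have vT : unit_box (v (inf B)).
  apply: box_closed => // x; rewrite in_itv/= => /andP[x0 xT].
  apply: contrapT => vx; move: xT; rewrite ltNge => /negP; apply.
  by apply: ge_inf => //; exists 0.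
have [|e/= e0 eP] := near_unit_box vT _.
  move=> i; apply: differentiable_continuous; apply/derivable1_diffP.
  by have [] := vid i T0.
have [x Bx xT] := inf_adherent e0 Binf.
have [_ []] := Bx; apply: eP => /=.
have Tx : inf B <= x by apply: ge_inf => //; exists 0.
by rewrite ler0_norm ?subr_le0// opprB ltrBlDl.
Qed.

Lemma trajectory_sign_sum (t : R) i : 0 <= t ->
  sign_sum W (v t) i = sign_sum W (v 0) i.
Proof.
move=> t0; apply: box_sign_sum => // x; rewrite in_itv/= => /andP[x0 _].
exact: trajectory_in_box.
Qed.

Lemma trajectory_cvg : v t @[t --> +oo] --> target W (v 0).
Proof.
apply: cvg_row => i.
have e0 : expR (- (rate i * t)) @[t --> +oo] --> (0 : R).
  exact: (cvg_comp _ _ (gt0_cvgMry (rate_gt0 i) cvg_id) (@cvgr_expR R)).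
pose x := target W (v 0) ord0 i.
have : x + (v 0 ord0 i - x) * expR (- (rate i * t)) @[t --> +oo] --> x.
  rewrite -[X in _ --> X]addr0 -[X in _ --> _ + X](mulr0 (v 0 ord0 i - x)).
  exact: cvgD (cvg_cst _) (cvgM (cvg_cst _) e0).
apply: cvg_trans; apply: near_eq_cvg; near=> t.
rewrite (@box_sol t)// => y; rewrite in_itv/= => /andP[y0 _].
exact: trajectory_in_box.
Unshelve. all: by end_near. Qed.

End trajectory.

(** * Limit, steady states and strict minimality on the closed chamber *)

Theorem theorem3 (R : realType) (N : nat) (W : 'M[R]_N) (a : R)
    (v : R -> 'rV[R]_N)
    (W_ge0 : forall i j : 'I_N, 0 <= W i j)
    (W_diag : forall i : 'I_N, 0 < W i i)
    (W_sym : W^T = W)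
    (a_gt0 : 0 < a)
    (v0_box : unit_box (v 0))
    (v_evol : evolves W a v) :
  exists vs : 'rV[R]_N,
    [/\ unit_box vs,
        v t @[t --> +oo] --> vs,
        (forall u : 'rV[R]_N, steady_in W a (chamber W (v 0)) u <-> u = vs),
        (forall u : 'rV[R]_N, chamber W (v 0) u ->
           velocity W a u = 0 <-> u = vs)
      & (forall u : 'rV[R]_N, closure (chamber W (v 0)) u -> u != vs ->
           energy W a vs < energy W a u)].
Proof.
have [w [wv wd]] := evolves_ext v_evol.
have w0 : w 0 = v 0 by rewrite wv.
have w0_box : unit_box (w 0) by rewrite w0.
set A := chamber W (v 0); set vs := target W (v 0).
have rate0 i : 2 * a * degree W i != 0.
  by rewrite gt_eqF// !mulr_gt0// degree_gt0.
have wvs : w t @[t --> +oo] --> vs.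
  by rewrite /vs -w0; exact: (trajectory_cvg W_ge0 W_diag a_gt0 w0_box wd).
have velA u i : A u ->
    velocity W a u ord0 i = 2 * a * degree W i * (vs ord0 i - u ord0 i).
  move=> Au; rewrite /vs -(chamber_target W_ge0 W_sym Au) velocity_target//.
  exact: Au.1.
(* The conserved sign sums keep the trajectory in [A]; interacting particles may still meet in the
   limit, hence the closure. *)
have vsA : closure A vs.
  apply: (closed_cvg _ (@closed_closure _ A) _ _ wvs).
  near=> t; have : A (w t); last exact: subset_closure.
  rewrite /A -w0.
  apply/(chamber_sign_sum W_ge0 W_sym); first exact: trajectory_in_box.
  by move=> i; exact: trajectory_sign_sum.
have velvs u : closure A u ->
    velocity W a z @[z --> within A (nbhs u)] -->
      \row_i (2 * a * degree W i * (vs ord0 i - u ord0 i)).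
  move=> Au; apply: cvg_row => i; rewrite mxE.
  have : 2 * a * degree W i * (vs ord0 i - z ord0 i) @[z --> within A (nbhs u)]
      --> 2 * a * degree W i * (vs ord0 i - u ord0 i).
    have zu : z ord0 i @[z --> within A (nbhs u)] --> u ord0 i.
      exact: (cvg_within_filter _ (@coord_continuous _ _ _ ord0 i u)).
    exact: cvgM (cvg_cst _) (cvgB (cvg_cst _) zu).
  apply: cvg_trans; apply: near_eq_cvg; rewrite near_withinE.
  by apply: nearW => z Az; rewrite velA.
exists vs; split.
- exact: target_in_box.
- by apply: cvg_trans wvs; apply: near_eq_cvg; near=> t; rewrite wv.
- move=> u; split=> [[Au u0]|->].
    (* As [u] is in the closure of [A], limits along [A] at [u] are unique, so the affine extension
       of the velocity must vanish at [u]. *)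
    have pA : ProperFilter (within A (nbhs u)) by exact: within_nbhs_proper.
    have /rowP u0E :
        \row_i (2 * a * degree W i * (vs ord0 i - u ord0 i)) = 0 :> 'rV[R]_N.
      exact: (cvg_unique (@norm_hausdorff _ _) (velvs u Au) u0).
    apply/rowP => i; have := u0E i; rewrite !mxE => /eqP.
    by rewrite mulf_eq0 (negPf (rate0 i)) subr_eq0 => /eqP.
  split=> //; have := velvs vs vsA.
  rewrite [X in _ --> X](_ : _ = 0)//.
  by apply/rowP => i; rewrite !mxE subrr mulr0.
- move=> u Au; split=> [/rowP u0|uE]; apply/rowP => i.
    have := u0 i; rewrite velA// [RHS]mxE => /eqP.
    by rewrite mulf_eq0 (negPf (rate0 i)) subr_eq0 => /eqP.
  by rewrite velA// uE subrr mulr0 mxE.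
- move=> u Au uvs; rewrite !(energyE a W_ge0 W_diag W_sym (x := v 0))//.
  rewrite -/vs ltr_pM2l ?mulr_gt0// -subr_gt0 -sumrB.
  (* One coordinate where [u] and [vs] differ makes the sum of squares strictly positive. *)
  have /existsP[i ui] : [exists i, u ord0 i != vs ord0 i].
    apply: contraNT uvs => /existsPn ui; apply/eqP/rowP => i.
    by apply/eqP; have := ui i; rewrite negbK.
  rewrite (bigD1 i)//=; apply: ltr_wpDr.
    apply: sumr_ge0 => j _; rewrite -mulrBr mulr_ge0//.
      by rewrite ltW// degree_gt0.
    by rewrite subrr expr0n/= sub0r opprK subrK sqr_ge0.
  rewrite -mulrBr mulr_gt0 ?degree_gt0// subrr expr0n/= sub0r opprK subrK.
  by rewrite lt_neqAle sqr_ge0 eq_sym sqrf_eq0 subr_eq0 ui.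
Unshelve. all: by end_near. Qed.
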